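(* Let $(\bar m,\bar s,g(x),j)$ be one of the following: (i) $\bar m=3$, $\bar s\in\{1,2\}$, $g=x^3+x+1$, $j=1$; (ii) $\bar m=3$, $\bar s\in\{1,2\}$, $g=x^3+x^2+1$, $j=2$; (iii) $\bar m=4$, $\bar s\in\{1,3\}$, $g=x^4+x^3+x^2+x+1$, $j=2$; (iv) $\bar m=5$, $\bar s\in\{1,2,3,4\}$, $g=x^5+x^4+x^3+x^2+1$, $j=1$; (v) $\bar m=7$, $\bar s\in\{1,\dots,6\}$, $g=x^7+x^5+x^3+x+1$, $j=2$; (vi) $\bar m=9$, $\bar s\in\{1,2,4,5,7,8\}$, $g=x^9+x^4+1$, $j=1$; (vii) $\bar m=9$, $\bar s\in\{1,2,4,5,7,8\}$, $g=x^9+x^8+1$, $j=2$. Let $m,s,t$ be positive integers with $m=\bar m t$, $3\nmid t$, $\gcd(m,s)=1$, $\bar m\mid (s-\bar s)$ and $3\mid (s+jt)$. Let $\mu\in\mathbb{F}_{2^{\bar m}}$ be a root of $g(x)$. Let $\bar H:\mathbb{F}_{2^{3\bar m}}\to\mathbb{F}_{2^{3\bar m}}$, $\bar H(x)=\mu x^{2^{\bar s}}+x^{2^{\bar s+\bar m}}$ and $H:\mathbb{F}_{2^{3m}}\to\mathbb{F}_{2^{3m}}$, $H(x)=\mu x^{2^s}+x^{2^{s+m}}$, and denote by $\bar H^{k}$, $H^k$ their $k$-fold compositions. Then \[\bar H^{\bar m}(x)=x^{2^{\bar m(\bar s+j)}}\ \text{ for all } x\in\mathbb{F}_{2^{3\bar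 m}},\qquad H^m(x)=x^{2^{m(s+jt)}}\ \text{ for all } x\in\mathbb{F}_{2^{3m}}.\] Hence $H^m(x)=x$ for all $x\in\mathbb{F}_{2^{3m}}$ and $\dim_{\mathbb{F}_2}\ker(f_\mu^{(s)})=3$, where $f_\mu^{(s)}(x)=x^{2^{m+s}}+\mu x^{2^s}+x\in\mathbb{F}_{2^{3m}}[x]$. In particular $\mathrm{N}_{2^{3m}/2^m}(\mu)\neq1$.
   Context: $\ker(f_\mu^{(s)})$ is the $\mathbb{F}_2$-space of roots of $f_\mu^{(s)}$ in $\mathbb{F}_{2^{3m}}$; $\mathrm{N}_{2^{3m}/2^m}(\mu)=\mu^{2^{2m}+2^m+1}$. Since $\bar m\mid m$, $\mu\in\mathbb{F}_{2^{\bar m}}\subseteq\mathbb{F}_{2^{3m}}$. *)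

(* Defs.v *)
From HB Require Import structures.
From mathcomp Require Import all_boot all_order all_algebra all_fingroup all_field.

Set Implicit Arguments.
Unset Strict Implicit.
Unset Printing Implicit Defensive.

Import GRing.Theory.
Local Open Scope ring_scope.

(* F_{2^n} is represented as a fieldExtType 'F_2 with \dim {:_} = n. *)

Definition admissible (mb sb : nat) (g : {poly 'F_2}) (j : nat) : Prop :=
     [/\ mb = 3%N, sb \in [:: 1; 2]%N, g = 'X^3 + 'X + 1 & j = 1%N]
  \/ [/\ mb = 3%N, sb \in [:: 1; 2]%N, g = 'X^3 + 'X^2 + 1 & j = 2%N]
  \/ [/\ mb = 4%N, sb \in [:: 1; 3]%N, g = 'X^4 + 'X^3 + 'X^2 + 'X + 1 & j = 2%N]
  \/ [/\ mb = 5%N, sb \in [:: 1; 2; 3; 4]%N,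
         g = 'X^5 + 'X^4 + 'X^3 + 'X^2 + 1 & j = 1%N]
  \/ [/\ mb = 7%N, sb \in [:: 1; 2; 3; 4; 5; 6]%N,
         g = 'X^7 + 'X^5 + 'X^3 + 'X + 1 & j = 2%N]
  \/ [/\ mb = 9%N, sb \in [:: 1; 2; 4; 5; 7; 8]%N, g = 'X^9 + 'X^4 + 1 & j = 1%N]
  \/ [/\ mb = 9%N, sb \in [:: 1; 2; 4; 5; 7; 8]%N, g = 'X^9 + 'X^8 + 1 & j = 2%N].

Definition Hmap (F : nzRingType) (mu : F) (m s : nat) (x : F) : F :=
  mu * x ^+ (2 ^ s) + x ^+ (2 ^ (s + m)).

Definition fpoly (F : nzRingType) (mu : F) (m s : nat) : {poly F} :=
  'X^(2 ^ (m + s)) + mu *: 'X^(2 ^ s) + 'X.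

Definition norm_3m_m (F : nzRingType) (m : nat) (mu : F) : F :=
  mu ^+ (2 ^ (2 * m) + 2 ^ m + 1).

Lemma frob2_linear (L : fieldExtType 'F_2) (n : nat) :
  linear (fun x : L => x ^+ (2 ^ n)).
Proof.
have ch : 2 \in [pchar L] by rewrite pchar_lalg pchar_Fp.
move=> a u v /=; elim: n => [|n IHn]; first by rewrite expn0 !expr1.
rewrite expnSr !exprM IHn -!(pFrobenius_autE ch) rmorphD /= !pFrobenius_autE.
rewrite exprZn; suff -> : a ^+ 2 = a by [].
by case: a {IHn} => [[|[|[]]] ?] //; apply/val_inj.
Qed.

Lemma fpoly_linear (L : fieldExtType 'F_2) (mu : L) (m s : nat) :
  linear (horner (fpoly mu m s)).
Proof.
move=> a u v; rewrite !hornerE /=.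
rewrite (frob2_linear (m + s) a u v) (frob2_linear s a u v).
rewrite mulrDr -scalerAr !scalerDr.
by rewrite addrACA; congr (_ + _); rewrite addrAC addrA.
Qed.

(* linfun is only meaningful on linear maps; mem_fker checks that this is the
   set of roots of fpoly. *)
Definition fker (L : fieldExtType 'F_2) (mu : L) (m s : nat) : {vspace L} :=
  lker (linfun (horner (fpoly mu m s))).

Lemma mem_fker (L : fieldExtType 'F_2) (mu : L) (m s : nat) (x : L) :
  (x \in fker mu m s) = root (fpoly mu m s) x.
Proof.
pose M := GRing.isLinear.Build _ _ _ _ _ (fpoly_linear mu m s).
pose f : {linear L -> L} := HB.pack (horner (fpoly mu m s)) M.
by rewrite memv_ker /root -[horner _]/(f : L -> L) lfunE.
Qed.

(* Main.v *)
(* Let tau be the m-th power of the Frobenius sigma; it has order 3 on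
   F_{2^(3m)}, it fixes mu, and H = (mu + tau) sigma^s. Moving the powers of
   sigma to the right,
     H^mb = prod_{i < mb} (sigma^(s i)(mu) + tau) sigma^(s mb)
          = g(tau) sigma^(s mb),
   because the sigma^(s i)(mu) are the mb distinct roots of g. In every case
   g = x^j modulo x^3 - 1, so g(tau) = tau^j and H^mb = tau^j sigma^(s mb).
   The same congruence shows mu^3 <> 1 (otherwise 0 = g(mu) = mu^j), which is
   the claim on the norm and also keeps mu out of the proper subfields F_2 and
   F_4 (F_8, which matters when mb = 9, is excluded by evaluating g).
   The kernel of f is the fixed space of H. As H is semilinear over F_{2^m}
   and H^m = 1, Galois descent gives it dimension 3 over F_2. *)

From HB Require Import structures.
Require Import Defs.
From mathcomp Require Import all_boot all_order all_algebra all_fingroup all_field.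
From mathcomp Require Import ring.

Import GRing.Theory.
Local Open Scope ring_scope.

Set Implicit Arguments.
Unset Strict Implicit.
Unset Printing Implicit Defensive.

(** * Powers of the Frobenius and their fixed points *)

Section Frobenius.
Variable L : fieldExtType 'F_2.

Lemma pchar2_ext : 2 \in [pchar L].
Proof. by rewrite pchar_lalg pchar_Fp. Qed.

Definition frob (n : nat) (x : L) : L := x ^+ (2 ^ n).

Lemma frob_additive n : zmod_morphism (frob n).
Proof.
move=> x y; have := frob2_linear n (-1) y x.
by rewrite !scaleN1r ![- _ + _]addrC.
Qed.

Lemma frob_multiplicative n : monoid_morphism (frob n).
Proof. by split=> [|x y]; rewrite /frob ?expr1n ?exprMn. Qed.

HB.instance Definition _ n :=
  GRing.isZmodMorphism.Build L L (frob n) (frob_additive n).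
HB.instance Definition _ n :=
  GRing.isMonoidMorphism.Build L L (frob n) (frob_multiplicative n).

Lemma frobD a b x : frob (a + b) x = frob b (frob a x).
Proof. by rewrite /frob -exprM expnD. Qed.

Lemma frobC a b x : frob a (frob b x) = frob b (frob a x).
Proof. by rewrite -!frobD addnC. Qed.

Lemma frob_in_alg n (c : 'F_2) : frob n (in_alg L c) = in_alg L c.
Proof.
rewrite /frob -rmorphXn; congr (_%:A); elim: n => // n IHn.
by rewrite expnSr exprM IHn; case: c {IHn} => [[|[|[]]] ?] //; apply/val_inj.
Qed.

Lemma frob_mul_fix n k x : frob n x = x -> frob (k * n) x = x.
Proof. by move=> fx; elim: k => // k IHk; rewrite mulSn frobD fx. Qed.

(** Bezout in the subtraction-free form [u * a = v * b + gcdn a b]: both [frob (u * a)] and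
    [frob (v * b)] fix [x]. *)
Lemma frob_gcd_fix a b x : frob a x = x -> frob b x = x -> frob (gcdn a b) x = x.
Proof.
case: (posnP a) => [->|a_gt0 fa fb]; first by rewrite gcd0n.
case: (egcdnP b a_gt0) => u v uv _.
by rewrite -[RHS](frob_mul_fix u fa) uv frobD (frob_mul_fix v fb).
Qed.

Lemma frob_dim (M : {subfield L}) x : (x \in M) = (frob (\dim M) x == x).
Proof. by rewrite Fermat's_little_theorem card_Fp. Qed.

(** * Distinct conjugates and factorization of polynomials over F_2 *)

Definition conjugates n s x := [seq frob (s * i) x | i <- iota 0 n].

(** By injectivity of [frob], two equal conjugates give [frob (s * d) x = x] for some [0 < d < n].
    Then [x] is fixed by the power [gcdn n (s * d) = gcdn n d], a proper divisor of [n]. *)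
Lemma uniq_conjugates n s x : frob n x = x ->
    (forall d, (d %| n)%N -> (d < n)%N -> frob d x != x) ->
  coprime n s -> uniq (conjugates n s x).
Proof.
move=> fx fxd co_ns; rewrite map_inj_in_uniq ?iota_uniq // => i k.
rewrite !mem_iota /= !add0n.
wlog lt_ik: i k / (i <= k)%N.
  by move=> IH ? ? E; case/orP: (leq_total i k) => ?; [|symmetry]; apply: IH.
move=> _ lt_kn; rewrite -(subnKC lt_ik) mulnDr addnC frobD.
move=> /esym/fmorph_inj => [].
rewrite -(subnKC lt_ik) addKn.
move: (_ - _)%N (leq_ltn_trans (leq_subr i k) lt_kn).
case=> [|d] lt_dn; first by rewrite addn0.
move=> fd; have := frob_gcd_fix fx fd; rewrite Gauss_gcdr // => /eqP.
rewrite (negPf (fxd _ _ _)) ?dvdn_gcdl //.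
by apply: leq_ltn_trans lt_dn; rewrite dvdn_leq // dvdn_gcdr.
Qed.

Lemma root_conjugates n s x (g : {poly 'F_2}) :
  root (map_poly (in_alg L) g) x ->
  all (root (map_poly (in_alg L) g)) (conjugates n s x).
Proof.
move=> gx; apply/allP=> _ /mapP[i _ ->].
suff -> : map_poly (in_alg L) g = map_poly (frob (s * i)) (map_poly (in_alg L) g).
  by rewrite fmorph_root.
by rewrite -map_poly_comp; apply: eq_map_poly => c /=; rewrite -in_algE frob_in_alg.
Qed.

Lemma map_poly_conjugates n s x (g : {poly 'F_2}) :
  g \is monic -> size g = n.+1 -> root (map_poly (in_alg L) g) x ->
  uniq (conjugates n s x) ->
  map_poly (in_alg L) g = \prod_(i < n) ('X - (frob (s * i) x)%:P).
Proof.
move=> mon_g sz_g gx Uc.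
rewrite [LHS](@all_roots_prod_XsubC _ _ (conjugates n s x)).
- rewrite lead_coef_map (monicP mon_g) rmorph1 scale1r big_map.
  by rewrite -(big_mkord xpredT (fun i => 'X - (frob (s * i) x)%:P)) /index_iota subn0.
- by rewrite size_map_poly sz_g size_map size_iota.
- exact: root_conjugates.
- by rewrite uniq_rootsE.
Qed.

(** * Polynomials in a power of the Frobenius, and iterates of [Hmap] *)

(* [twist m y p] is p(tau) y, where tau is the m-th power of the Frobenius. *)
Definition twist m (y : L) (p : {poly L}) :=
  \sum_(k < size p) p`_k * frob (m * k) y.

Lemma twist_wide m (p : {poly L}) y N : (size p <= N)%N ->
  twist m y p = \sum_(k < N) p`_k * frob (m * k) y.
Proof.
move=> leN; rewrite /twist (big_ord_widen N (fun k => p`_k * frob (m * k) y)) //.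
rewrite big_mkcond; apply: eq_bigr => k _; case: ltnP => // le_k.
by rewrite nth_default // mul0r.
Qed.

Lemma twist_is_linear m y : linear_for *%R (twist m y).
Proof.
move=> c p q; pose N := maxn (size p) (size q).
rewrite (@twist_wide m _ y N) ?(@twist_wide m p y N) ?(@twist_wide m q y N);
  rewrite ?leq_maxl ?leq_maxr //.
  rewrite mulr_sumr -big_split; apply: eq_bigr => k _ /=.
  by rewrite coefD coefZ mulrDl -mulrA.
rewrite (leq_trans (size_polyD _ _)) // geq_max leq_maxr andbT.
by rewrite (leq_trans (size_scale_leq _ _)) ?leq_maxl.
Qed.

HB.instance Definition _ m y :=
  GRing.isLinear.Build L {poly L} L *%R (twist m y) (twist_is_linear m y).

Lemma twistMX m (p : {poly L}) y : twist m y (p * 'X) = twist m (frob m y) p.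
Proof.
rewrite (@twist_wide m (p * 'X) y (size p).+1); last first.
  by have [->|p0] := eqVneq p 0; rewrite ?mul0r ?size_poly0 // size_mulX.
rewrite big_ord_recl coefMX mul0r add0r; apply: eq_bigr => k _.
by rewrite coefMX /= /bump add1n mulnS frobD.
Qed.

Lemma twistMXn m p k y : twist m y (p * 'X^k) = twist m (frob (m * k) y) p.
Proof.
elim: k y => [|k IHk] y; first by rewrite mulr1 muln0.
by rewrite exprSr mulrA twistMX IHk mulnS frobD.
Qed.

Lemma twist1 m y : twist m y 1 = y.
Proof. by rewrite /twist size_poly1 big_ord1 coef1 mul1r muln0. Qed.

Lemma twist_addr m p y z : twist m (y + z) p = twist m y p + twist m z p.
Proof. by rewrite -big_split; apply: eq_bigr => k _; rewrite raddfD mulrDr. Qed.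

Lemma twist_mulr m p c y : frob m c = c -> twist m (c * y) p = c * twist m y p.
Proof.
move=> fc; rewrite mulr_sumr; apply: eq_bigr => k _.
by rewrite rmorphM /= (mulnC m) (frob_mul_fix k fc) mulrCA.
Qed.

Lemma Hmap_frob (nu : L) m s x : Hmap nu m s x = nu * frob s x + frob m (frob s x).
Proof. by rewrite -frobD. Qed.

(** The induction peels off the innermost [Hmap], which yields the last factor, with root
    [frob (s * n) nu]. This scalar can be pulled out of p(tau) because tau fixes it. *)
Lemma iter_Hmap (nu : L) m s n x : frob m nu = nu ->
  iter n (Hmap nu m s) x =
    twist m (frob (s * n) x) (\prod_(i < n) ('X - (frob (s * i) nu)%:P)).
Proof.
move=> fnu; elim: n x => [|n IHn] x; first by rewrite big_ord0 twist1 muln0.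
rewrite iterSr IHn big_ord_recr /= mulrBr raddfB /= twistMX.
rewrite [_ * _%:P]mulrC mul_polyC linearZ Hmap_frob /=.
rewrite rmorphD /= rmorphM twist_addr /=.
rewrite twist_mulr; last by rewrite frobC fnu.
(* Characteristic 2 reconciles the minus sign of ['X - c] with the plus sign in [Hmap]. *)
rewrite (oppr_pchar2 pchar2_ext) addrC.
by congr (twist _ _ _ + _ * twist _ _ _); rewrite -!frobD; congr (frob _ x); ring.
Qed.

(** Since tau^3 = 1, the term [q * ('X^3 - 1)] acts as zero and only ['X^j] survives. *)
Lemma iter_Hmap_norm (g q : {poly 'F_2}) (nu : L) n m s j x :
    g = 'X^j + q * ('X^3 - 1) -> g \is monic -> size g = n.+1 ->
    root (map_poly (in_alg L) g) nu -> uniq (conjugates n s nu) ->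
    frob m nu = nu -> (forall y, frob (m * 3) y = y) ->
  iter n (Hmap nu m s) x = frob (m * j + s * n) x.
Proof.
move=> def_g mon_g sz_g gnu Uc fnu f3.
rewrite iter_Hmap // -(map_poly_conjugates mon_g) // def_g.
rewrite rmorphD rmorphM rmorphB rmorph1 /= !map_polyXn mulrBr mulr1.
rewrite raddfD raddfB /= twistMXn f3 subrr addr0.
by rewrite -['X^j]mul1r twistMXn twist1 -frobD addnC.
Qed.

(** * Subfields generated by roots of unity of order 2^n - 1 *)

(** The order 2^n - 1 of [theta] divides 2^d - 1, which is positive because [0 < d]. *)
Lemma frob_prim n d (theta : L) : (0 < d)%N ->
  (2 ^ n - 1).-primitive_root theta -> frob d theta = theta -> (n <= d)%N.
Proof.
move=> d_gt0 prim fd; have th0 : theta != 0.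
  apply/eqP=> th0; have := prim_expr_order prim; rewrite th0 expr0n.
  by rewrite eqn0Ngt (prim_order_gt0 prim) => /eqP; rewrite eq_sym oner_eq0.
have d2 : (1 < 2 ^ d)%N by rewrite -{1}(expn0 2) ltn_exp2l.
have /eqP : theta ^+ (2 ^ d - 1) = 1.
  by apply: (mulfI th0); rewrite -exprS subn1 prednK ?expn_gt0 // mulr1.
rewrite -(prim_order_dvd prim) => /dvdn_leq; rewrite subn_gt0 => /(_ d2).
by rewrite leq_sub2rE ?expn_gt0 // leq_exp2l.
Qed.

Lemma frob_prim_id n (theta : L) :
  (2 ^ n - 1).-primitive_root theta -> frob n theta = theta.
Proof.
move=> prim; rewrite /frob -(subnK (expn_gt0 2 n)) exprD (prim_expr_order prim).
by rewrite mul1r.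
Qed.

Lemma uniq_conjugates_prim n s (theta : L) : (0 < n)%N ->
  (2 ^ n - 1).-primitive_root theta -> coprime n s -> uniq (conjugates n s theta).
Proof.
move=> n_gt0 prim; apply: uniq_conjugates => [|d dn lt_dn]; first exact: frob_prim_id.
apply/eqP=> /(frob_prim (dvdn_gt0 n_gt0 dn) prim).
by rewrite leqNgt lt_dn.
Qed.

(** The nonzero elements of [L] are [N] distinct [N]-th roots of unity, so one of them is primitive;
    2^n - 1 divides [N], and a power of that element has the required order. *)
Lemma has_prim_pow2 n : (0 < n)%N -> (n %| \dim {:L})%N ->
  exists theta : L, (2 ^ n - 1).-primitive_root theta.
Proof.
move=> n_gt0 /dvdnP[k dimL]; pose N := (2 ^ \dim {:L} - 1)%N.
have N_gt0 : (0 < N)%N.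
  by rewrite subn_gt0 -{1}(expn0 2) ltn_exp2l // adim_gt0.
have [zeta prim] : exists zeta : L, N.-primitive_root zeta.
  pose F := finvect_type L; pose rs := enum (predC1 (0 : F)).
  have: has N.-primitive_root rs.
    apply: cyclic.has_prim_root => //.
    - apply/allP=> x; rewrite mem_enum inE => x0; apply/unity_rootP.
      apply: (mulfI x0); rewrite -exprS mulr1 /N subn1 prednK ?expn_gt0 //.
      by apply/eqP; rewrite -[_ ^+ _]/(frob _ _) -(frob_dim {:L}%AS) memvf.
    - exact: enum_uniq.
    have := card_vspace {: F}; rewrite card_vspacef card_Fp // => cardF.
    by rewrite -cardE cardC1 cardF /N subn1.
  by case/hasP=> zeta _ ?; exists zeta.
have dvN : (2 ^ n - 1 %| N)%N.
  rewrite /N dimL mulnC expnM.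
  by have := subn_exp (2 ^ n) 1 k; rewrite exp1n => ->; apply: dvdn_mulr.
by exists (zeta ^+ (N %/ (2 ^ n - 1))); apply: dvdn_prim_root.
Qed.

(** The lower bound is [frob_prim] applied to the Frobenius power that fixes the generated field;
    for the upper bound, the minimal polynomial divides a product of [n] linear factors with
    coefficients in F_2. *)
Lemma dim_prim_pow2 n (theta : L) : (0 < n)%N ->
  (2 ^ n - 1).-primitive_root theta -> \dim <<1; theta>> = n.
Proof.
move=> n_gt0 prim; apply/eqP; rewrite eqn_leq andbC.
have thM := memv_adjoin 1%AS theta.
rewrite (frob_prim (adim_gt0 _) prim) ?andTb; last by apply/eqP; rewrite -frob_dim.
pose P := \prod_(i < n) ('X - (frob i theta)%:P).
have P1 : P \is a polyOver 1%AS.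
  (* The Frobenius permutes the factors cyclically: the last becomes the first because
     [frob n theta = theta]. *)
  have fP : map_poly (frob 1) P = P.
    rewrite rmorph_prod /=; under eq_bigr do
      rewrite rmorphB /= map_polyX map_polyC /= -frobD addn1.
    rewrite /P; case: n n_gt0 prim {P} => // n _ prim.
    by rewrite big_ord_recr [RHS]big_ord_recl mulrC frob_prim_id.
  by apply/polyOverP=> i; rewrite frob_dim dimv1 -{2}fP coef_map.
have := minPoly_dvdp P1; rewrite dim_Fadjoin dimv1 muln1 => /(_ theta).
have -> : root P theta.
  rewrite /root horner_prod (bigD1 (Ordinal n_gt0)) //= hornerXsubC.
  by rewrite /frob expr1 subrr mul0r.
have P0 : P != 0 by rewrite monic_neq0 // monic_prod_XsubC.
move=> /(_ isT) /(dvdp_leq P0).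
by rewrite size_minPoly size_prod_XsubC /index_enum -enumT size_enum_ord.
Qed.

(** * Galois descent for semilinear maps *)

(* Writing q for the product of the X - theta_i over the conjugates
   theta_i <> theta, the b k are the coefficients of q / q(theta): they pick
   out the identity among the powers of the Frobenius. *)
Lemma conjugates_dual (M : {subfield L}) m s (theta : L) :
    (0 < m)%N -> theta \in M -> uniq (conjugates m s theta) ->
  exists2 b : nat -> L, (forall k, b k \in M) &
    forall z : nat -> L,
      \sum_(k < m) b k * (\sum_(i < m) frob (s * i) (theta ^+ k) * z i) = z 0%N.
Proof.
move=> m_gt0 thM Uc; pose q := \prod_(1 <= i < m) ('X - (frob (s * i) theta)%:P).
have qE : q = \prod_(c <- [seq frob (s * i) theta | i <- index_iota 1 m])
                ('X - c%:P) by rewrite big_map.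
have qM : q \is a polyOver M.
  by apply: rpred_prod => i _; rewrite polyOverXsubC rpredX.
have qth : q.[theta] != 0.
  rewrite -[_ == 0]/(root q theta) qE root_prod_XsubC.
  move: Uc; rewrite /conjugates -[m in iota 0 m](prednK m_gt0) /= muln0.
  by case/andP; rewrite /index_iota subn1.
exists (fun k => q`_k / q.[theta]) => [k|z].
  by rewrite rpred_div ?rpred_horner // (polyOverP qM).
have sz_q : size q = m.
  by rewrite size_prod_XsubC size_iota subn1 prednK.
(* Summing over [k] first assembles the values of [q] at the conjugates; all vanish except the one
   at [theta] itself. *)
transitivity (q.[theta]^-1 * \sum_(i < m) q.[frob (s * i) theta] * z i).
  rewrite mulr_sumr; under eq_bigr do rewrite mulr_sumr.
  rewrite exchange_big; apply: eq_bigr => i _ /=.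
  rewrite [q.[frob _ _]]horner_coef sz_q mulr_suml mulr_sumr; apply: eq_bigr => k _.
  by rewrite rmorphXn; ring.
rewrite -(prednK m_gt0) big_ord_recl muln0 big1 => [|i _].
  by rewrite addr0 mulKf.
rewrite (_ : q.[_] = 0) ?mul0r //; apply/rootP.
rewrite qE root_prod_XsubC; apply: map_f.
by rewrite mem_index_iota /= -[X in (_ < X)%N](prednK m_gt0) ltnS ltn_ord.
Qed.

(** Galois descent in two inequalities: [W] spans [L] over [M], the field of 2^m elements, and a
    basis of [W] over F_2 stays independent over [M]. *)
Lemma semilinear_fixed_dim (H : {additive L -> L}) (W : {vspace L}) m s :
    (0 < m)%N -> (m %| \dim {:L})%N -> coprime m s ->
    (forall a x, frob m a = a -> H (a * x) = frob s a * H x) ->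
    (forall x, iter m H x = x) -> (forall x, (x \in W) = (H x == x)) ->
  (m * \dim W)%N = \dim {:L}.
Proof.
move=> m_gt0 dvm co_ms semiH iterHm memW.
have [theta prim] := has_prim_pow2 m_gt0 dvm; pose M := <<1; theta>>%AS.
have dimM : \dim M = m by apply: dim_prim_pow2.
have frobM a : a \in M -> frob m a = a by rewrite frob_dim dimM => /eqP.
have thM : theta \in M by apply: memv_adjoin.
have [b bM dual] := conjugates_dual m_gt0 thM (uniq_conjugates_prim m_gt0 prim co_ms).
have HW x : x \in W -> H x = x by rewrite memW => /eqP.
have iterH i a x : a \in M -> iter i H (a * x) = frob (s * i) a * iter i H x.
  move=> aM; elim: i => [|i IHi]; first by rewrite muln0.
  rewrite !iterS IHi semiH; first by rewrite -frobD mulnS addnC.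
  by rewrite frobC frobM.
apply/eqP; rewrite eqn_leq; apply/andP; split; last first.
  (* x = sum_k (b k) Tr_H(theta^k x), where Tr_H = sum_i H^i maps into W. *)
  suff /eqP <- : (M * W == {:L})%VS by rewrite (leq_trans (dim_prodv _ _)) ?dimM.
  rewrite eqEsubv subvf; apply/subvP=> x _.
  have TW y : \sum_(i < m) iter i H y \in W.
    rewrite memW raddf_sum /=; under eq_bigr do rewrite -iterS.
    (* [H] shifts the summands by one, and the last wraps around to the first because [H] iterated
       [m] times is the identity. *)
    apply/eqP; case: (m) m_gt0 (iterHm y) => // n _ Hn.
    by rewrite big_ord_recr big_ord_recl Hn addrC.
  rewrite -[x](dual (fun i => iter i H x)); apply: memv_suml => k _.
  apply: memv_mul => //; have := TW (theta ^+ k * x).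
  by under eq_bigr do rewrite iterH ?rpredX //.
(* If sum_i (a i) w_i = 0, multiplying by c in M and applying Tr_H gives
   sum_i tr(c a_i) w_i = 0 with coefficients in F_2, so all tr(c a_i) = 0. *)
pose w := vbasis W.
have wW i : w`_i \in W.
  have [lt_i|le_i] := ltnP i (size w); last by rewrite nth_default ?mem0v.
  by apply: (vbasis_mem (U := W)); rewrite mem_nth.
have dirw : directv (\sum_(i < \dim W) (M * <[w`_i]>)).
  apply/directv_sum_independent=> u uM sum_u.
  have /fin_all_exists[a aP] i : exists a, a \in M /\ u i = a * w`_i.
    have /memv_cosetP[a aM ->] := uM i isT.
    by exists a.
  suff a0 i : a i = 0 by move=> i _; rewrite (aP i).2 a0 mul0r.
  (* Semilinearity and [H w = w] on [W] make [iter l H] conjugate the coefficients of a relation and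
     leave its vectors alone. *)
  have sum_iter l c : c \in M -> \sum_i frob (s * l) (c * a i) * w`_i = 0.
    move=> cM; have H0 : iter l H (\sum_i (c * a i) * w`_i) = 0.
      under eq_bigr do rewrite -mulrA -(aP _).2; rewrite -mulr_sumr sum_u mulr0.
      by elim: l => // l IHl; rewrite iterS IHl raddf0.
    rewrite -[RHS]H0; elim: l {H0} => [|l IHl].
      by apply: eq_bigr => k _; rewrite muln0.
    rewrite iterS -IHl raddf_sum; apply: eq_bigr => k _ /=.
    have fca : frob m (c * a k) = c * a k by rewrite frobM // rpredM // (aP k).1.
    rewrite semiH; first by rewrite HW // -frobD mulnS addnC.
    by rewrite frobC fca.
  pose tr c := \sum_(l < m) frob (s * l) c.
  (* The trace is fixed by [frob m] and, after a cyclic shift of its terms, by [frob s]; as [m] and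
     [s] are coprime, [frob 1] fixes it. *)
  have tr1 c : c \in M -> tr c \in 1%VS.
    move=> cM; rewrite (frob_dim 1%AS) dimv1; apply/eqP.
    have := @frob_gcd_fix m s (tr c); rewrite (eqP co_ms); apply.
      by rewrite raddf_sum; apply: eq_bigr => l _ /=; rewrite frobC frobM.
    have := frob_mul_fix s (frobM c cM).
    rewrite raddf_sum /tr /=; under eq_bigr do rewrite -frobD addnC -mulnS.
    case: (m) m_gt0 => // n _ fc.
    by rewrite big_ord_recr big_ord_recl /= fc muln0 addrC.
  have tr0 c : c \in M -> tr (c * a i) = 0.
    move=> cM; have /fin_all_exists[e eP] k : exists e, tr (c * a k) = e%:A.
      by apply/vlineP; apply: tr1; rewrite rpredM // (aP k).1.
    have /freeP/(_ e) : free w by apply: basis_free; apply: vbasisP.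
    rewrite eP => -> //; first by rewrite scale0r.
    under eq_bigr do rewrite -[w`_ _]mul1r scalerAl -eP mulr_suml.
    by rewrite exchange_big big1 // => l _; apply: sum_iter.
  (* Nondegeneracy of the trace: [dual] recovers [a i] from the traces of [theta ^+ k * a i], all of
     which are zero. *)
  have := dual (fun l => frob (s * l) (a i)); rewrite muln0 => ai.
  apply: etrans (esym ai) _.
  apply: big1 => k _; under eq_bigr do rewrite -rmorphM.
  by rewrite [X in _ * X]tr0 ?mulr0 // rpredX.
have := dimvS (subvf (\sum_(i < \dim W) (M * <[w`_i]>))).
rewrite (directvP dirw) /=; apply: leq_trans.
under eq_bigr => i _.
  rewrite dim_cosetv ?dimM; first by over.
  by rewrite (free_not0 (basis_free (vbasisP W))) // mem_nth ?size_tuple.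
by rewrite sum_nat_const card_ord mulnC.
Qed.

(** * [Hmap] as a semilinear map, with the kernel as its fixed space *)

Lemma Hmap_zmod_morphism (nu : L) m s : zmod_morphism (Hmap nu m s).
Proof. by move=> x y; rewrite !Hmap_frob !rmorphB /= mulrBr addrACA opprD. Qed.

HB.instance Definition _ nu m s :=
  GRing.isZmodMorphism.Build L L (Hmap nu m s) (Hmap_zmod_morphism nu m s).

Lemma Hmap_semilinear (nu : L) m s a x :
  frob m a = a -> Hmap nu m s (a * x) = frob s a * Hmap nu m s x.
Proof.
move=> fa; rewrite !Hmap_frob !rmorphM /= [frob m (frob s a)]frobC fa.
by rewrite mulrDr mulrCA.
Qed.

Lemma mem_fker_Hmap (nu : L) m s x : (x \in fker nu m s) = (Hmap nu m s x == x).
Proof.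
rewrite mem_fker /root !hornerE -[RHS]subr_eq0 (oppr_pchar2 pchar2_ext).
by rewrite [in RHS]/Hmap addnC [_ * _ + _]addrC.
Qed.

End Frobenius.

(** * Checking the seven admissible polynomials *)

Lemma size_monic_XnD n (r : {poly 'F_2}) : (size r <= n)%N ->
  'X^n + r \is monic /\ size ('X^n + r) = n.+1.
Proof.
move=> sz_r; rewrite monicE lead_coefDl ?size_polyDl ?size_polyXn //.
by rewrite lead_coefXn.
Qed.

Lemma admissible_spec mb sb g j : admissible mb sb g j ->
  [/\ (0 < mb)%N, coprime mb sb, g \is monic /\ size g = mb.+1, g`_0 = 1 &
      exists q, g = 'X^j + q * ('X^3 - 1)].
Proof.
have char2 : 2%:R = 0 :> {poly 'F_2} by apply/pcharf0; rewrite pchar_poly pchar_Fp.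
(* Here [r] is [g] without its leading term and [q] lifts the quotient modulo 2. The correction
   [2%:R * e] makes the congruence an identity with integer coefficients, within reach of [ring]. *)
pose spec mb sb (g : {poly 'F_2}) j := exists r q e : {poly 'F_2},
  [/\ (0 < mb)%N && coprime mb sb, g = 'X^mb + r, (size r <= mb)%N, r`_0 = 1
    & g = 'X^j + q * ('X^3 - 1) + 2%:R * e].
have specP : spec mb sb g j -> [/\ (0 < mb)%N, coprime mb sb,
    g \is monic /\ size g = mb.+1, g`_0 = 1 & exists q, g = 'X^j + q * ('X^3 - 1)].
  case=> r [q [e [/andP[mb_gt0 co] -> sz_r r0]]].
  rewrite char2 mul0r addr0 => gE; split=> //; last by exists q.
    exact: size_monic_XnD.
  by rewrite coefD r0 coefXn eq_sym eqn0Ngt mb_gt0 add0r.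
move=> adm; apply: specP.
have szD (p q : {poly 'F_2}) n :
  (size p <= n)%N -> (size q <= n)%N -> (size (p + q)%R <= n)%N.
  by move=> ? ?; rewrite (leq_trans (size_polyD _ _)) // geq_max; apply/andP.
have szX n k : (k < n)%N -> (size ('X^k : {poly 'F_2})%R <= n)%N by rewrite size_polyXn.
have szX1 n : (1 < n)%N -> (size ('X : {poly 'F_2})%R <= n)%N by rewrite size_polyX.
have sz1 n : (0 < n)%N -> (size (1 : {poly 'F_2})%R <= n)%N by rewrite size_poly1.
rewrite /spec {spec}; case: adm => [|[|[|[|[|[|]]]]]] [-> sbP -> ->].
- exists ('X + 1), 1, 1; split; [|ring|by rewrite !(szD, szX, szX1, sz1)| |ring].
    by move: sb sbP; apply/allP.
  by rewrite !coefE; apply/val_inj.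
- exists ('X^2 + 1), 1, 1; split; [|ring|by rewrite !(szD, szX, szX1, sz1)| |ring].
    by move: sb sbP; apply/allP.
  by rewrite !coefE; apply/val_inj.
- exists ('X^3 + 'X^2 + 'X + 1), ('X + 1), ('X + 1).
  split; [|ring|by rewrite !(szD, szX, szX1, sz1)| |ring].
    by move: sb sbP; apply/allP.
  by rewrite !coefE; apply/val_inj.
- exists ('X^4 + 'X^3 + 'X^2 + 1), ('X^2 + 'X + 1), ('X^2 + 1).
  split; [|ring|by rewrite !(szD, szX, szX1, sz1)| |ring].
    by move: sb sbP; apply/allP.
  by rewrite !coefE; apply/val_inj.
- exists ('X^5 + 'X^3 + 'X + 1), ('X^4 + 'X^2 + 'X + 1), ('X + 1).
  split; [|ring|by rewrite !(szD, szX, szX1, sz1)| |ring].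
    by move: sb sbP; apply/allP.
  by rewrite !coefE; apply/val_inj.
- exists ('X^4 + 1), ('X^6 + 'X^3 + 'X + 1), 1.
  split; [|ring|by rewrite !(szD, szX, szX1, sz1)| |ring].
    by move: sb sbP; apply/allP.
  by rewrite !coefE; apply/val_inj.
- exists ('X^8 + 1), ('X^6 + 'X^5 + 'X^3 + 'X^2 + 1), 1.
  split; [|ring|by rewrite !(szD, szX, szX1, sz1)| |ring].
    by move: sb sbP; apply/allP.
  by rewrite !coefE; apply/val_inj.
Qed.

(** * Roots of admissible polynomials lie in no proper subfield *)

Section AdmissibleRoot.
Variables (L : fieldExtType 'F_2) (mb sb : nat) (g : {poly 'F_2}) (j : nat).
Hypothesis adm : admissible mb sb g j.
Variable mu : L.
Hypothesis gmu : root (map_poly (in_alg L) g) mu.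

Lemma admissible_root_neq0 : mu != 0.
Proof.
have [_ _ _ g0 _] := admissible_spec adm.
apply/eqP=> mu0; move: gmu; rewrite mu0 /root horner_coef0 coef_map g0 /=.
by rewrite scale1r oner_eq0.
Qed.

Lemma admissible_root_cube : mu ^+ 3 != 1.
Proof.
have [_ _ _ _ [q gE]] := admissible_spec adm.
apply/eqP=> mu3; move: gmu; rewrite /root gE rmorphD rmorphM rmorphB rmorph1 /=.
rewrite !map_polyXn !hornerE mu3 subrr mulr0 addr0 expf_eq0.
by rewrite (negPf admissible_root_neq0) andbF.
Qed.

(** This provides distinct conjugates without proving [g] irreducible. The proper divisors of the
    possible [mb] are 1, 2 and 3, the last only for [mb = 9]. *)
Lemma admissible_root_degree d : (d %| mb)%N -> (d < mb)%N -> frob d mu != mu.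
Proof.
have frob2 : frob 2 mu != mu.
  apply: contra admissible_root_cube => /eqP mu4; apply/eqP.
  by apply: (mulfI admissible_root_neq0); rewrite -exprS mulr1.
have frob1 : frob 1 mu != mu.
  by apply: contra frob2 => /eqP/(frob_mul_fix 2) ->.
have frob3 : mb = 9%N -> frob 3 mu != mu.
  move=> mb9; apply: contra admissible_root_cube => /eqP mu8; move: gmu adm.
  have E8 : mu ^+ 8 = mu by [].
  have E9 : mu ^+ 9 = mu ^+ 2 by rewrite exprSr E8.
  have mu7 : mu ^+ 7 = 1.
    by apply: (mulfI admissible_root_neq0); rewrite -exprS mulr1.
  rewrite /admissible mb9 => g0 [[]|[[]|[[]|[[]|[[]|[[_ _ gE _]|[_ _ gE _]]]]]]] //.
    move: g0; rewrite /root gE !rmorphD rmorph1 /= !map_polyXn !hornerE E9 => /eqP g0.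
    (* Here [g] evaluates to mu^4 + mu^2 + 1, whose product with mu^2 - 1 is mu^6 - 1; together with
       mu^7 = 1 this forces mu = 1. *)
    have mu6 : mu ^+ 6 = 1.
      apply/eqP; rewrite -subr_eq0 -(mulr0 (mu ^+ 2 - 1)) -g0; apply/eqP; ring.
    by move: mu7; rewrite exprSr mu6 mul1r => ->; rewrite expr1n.
  move: g0; rewrite /root gE !rmorphD rmorph1 /= !map_polyXn !hornerE E9 E8 => /eqP g0.
  (* Here [g] evaluates to mu^2 + mu + 1, a factor of mu^3 - 1. *)
  by rewrite -subr_eq0 -(mulr0 (mu - 1)) -g0; apply/eqP; ring.
move: frob3; have : mb \in [:: 3; 4; 5; 7; 9]%N.
  by case: adm => [|[|[|[|[|[|]]]]]] [-> _ _ _].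
rewrite !inE => /or4P[|||/orP[]] /eqP -> frob3;
  case: d => [|[|[|[|[|[|[|[|[|]]]]]]]]] // _ _.
exact: frob3.
Qed.

End AdmissibleRoot.

Theorem theorem3p5
  (mb sb : nat) (g : {poly 'F_2}) (j : nat)
  (hadm : admissible mb sb g j)
  (m s t : nat) (m_gt0 : (0 < m)%N) (s_gt0 : (0 < s)%N) (t_gt0 : (0 < t)%N)
  (hm : m = (mb * t)%N) (ht : ~~ (3 %| t)%N) (hms : gcdn m s = 1%N)
  (hs : (mb%:Z %| s%:Z - sb%:Z)%Z) (hsjt : (3 %| s + j * t)%N)
  (K Lb L : fieldExtType 'F_2)
  (dimK : \dim {:K} = mb) (dimLb : \dim {:Lb} = (3 * mb)%N)
  (dimL : \dim {:L} = (3 * m)%N)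
  (iotab : {rmorphism K -> Lb}) (iota : {rmorphism K -> L})
  (mu : K) (hmu : root (map_poly (in_alg K) g) mu) :
  let Hb : Lb -> Lb := Hmap (iotab mu) mb sb in
  let H : L -> L := Hmap (iota mu) m s in
  (forall x : Lb, iter mb Hb x = x ^+ (2 ^ (mb * (sb + j)))) /\
  (forall x : L, iter m H x = x ^+ (2 ^ (m * (s + j * t)))) /\
  (forall x : L, iter m H x = x) /\
  \dim (fker (iota mu) m s) = 3%N /\
  norm_3m_m m (iota mu) != 1.
Proof.
move=> Hb H; have [mb_gt0 co_mbsb [mon_g sz_g] _ [q gE]] := admissible_spec hadm.
have root_iota (F : fieldExtType 'F_2) (f : {rmorphism K -> F}) :
  root (map_poly (in_alg F) g) (f mu).
  suff -> : map_poly (in_alg F) g = map_poly f (map_poly (in_alg K) g).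
    by rewrite fmorph_root.
  rewrite -map_poly_comp; apply: eq_map_poly => c /=.
  by rewrite -[c]natr_Zp !scaler_nat rmorphMn rmorph1.
have frob_mb (F : fieldExtType 'F_2) (f : {rmorphism K -> F}) :
  frob mb (f mu) = f mu.
  rewrite /frob -rmorphXn; congr (f _); apply/eqP.
  by rewrite -[_ ^+ _]/(frob _ _) -dimK -(frob_dim {:K}%AS) memvf.
(* Stated for any [n] and [r] to serve both maps: [n = 1], [r = sb] for [Hb], and [n = t], [r = s]
   for [H]. *)
have iter_mb (F : fieldExtType 'F_2) (f : {rmorphism K -> F}) n r x :
    \dim {:F} = (3 * (mb * n))%N -> coprime mb r ->
  iter mb (Hmap (f mu) (mb * n) r) x = frob (mb * n * j + r * mb) x.
  move=> dimF co_r; apply: (iter_Hmap_norm _ gE) => //.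
  - by apply: uniq_conjugates => // d; apply: (admissible_root_degree hadm).
  - by rewrite mulnC frob_mul_fix.
  - by move=> y; apply/eqP; rewrite mulnC -dimF -(frob_dim {:F}%AS) memvf.
have fmu : frob m (iota mu) = iota mu by rewrite hm mulnC frob_mul_fix.
have iterH x : iter m H x = frob (m * (s + j * t)) x.
  have co_mbs : coprime mb s.
    by have /eqP := hms; rewrite hm -/(coprime _ _) coprimeMl => /andP[].
  (* As [m = mb * t], the [m]-th iterate is the [t]-th iterate of the [mb]-th one, a pure Frobenius
     power. *)
  have iter_k k : iter (k * mb) H x = frob (k * (mb * t * j + s * mb)) x.
    elim: k => // k IHk; rewrite mulSn iterD IHk /H hm iter_mb -?hm //.
    by rewrite -frobD mulSn addnC.
  rewrite {1}hm mulnC iter_k hm; congr frob; ring.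
have iterHm x : iter m H x = x.
  (* Divisibility by 3 makes the exponent a multiple of [3 * m], the order of the Frobenius on
     [L]. *)
  case/dvdnP: hsjt => k sjt; rewrite iterH sjt mulnCA mulnC [(m * 3)%N]mulnC -dimL.
  rewrite mulnC; apply: frob_mul_fix; apply/eqP.
  by rewrite -(frob_dim {:L}%AS) memvf.
split=> [x|].
  rewrite /Hb; have := @iter_mb Lb iotab 1%N sb x; rewrite muln1 => -> //.
  by rewrite -/(frob _ _); congr frob; ring.
split; first exact: iterH.
split; first exact: iterHm.
split.
  apply/eqP; rewrite -(eqn_pmul2l m_gt0) [(m * 3)%N]mulnC -dimL; apply/eqP.
  apply: (semilinear_fixed_dim m_gt0 _ _ (@Hmap_semilinear L (iota mu) m s)).
  - by rewrite dimL dvdn_mull.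
  - exact/eqP.
  - exact: iterHm.
  - exact: mem_fker_Hmap.
(* Since [frob m] fixes [iota mu], its norm is just its cube. *)
rewrite /norm_3m_m !exprD -!/(frob _ _) (frob_mul_fix 2 fmu) fmu expr1.
by have := admissible_root_cube hadm (root_iota _ iota); rewrite !exprSr expr0 mul1r.
Qed.
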